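(* Let $f:\mathbb{R}\to[0,\infty)$ be a bounded probability density. Let $h\in L^\infty(\mathbb{R})$ with $h\ge0$, and let $\ell\in\mathbb{N}$ be such that $$\sup_{x\in[a,a+1)}f_\ell(x)\le\int_{a-1}^{a+2}h(w)\,\mathrm{d}w\qquad\text{for all }a\in\mathbb{R}.$$ Then $$\sup_{x\in[a,a+1)}f_{2\ell}(x)\le\int_{a-1}^{a+2}\Phi_\ell(h)(w)\,\mathrm{d}w\qquad\text{for all }a\in\mathbb{R}.$$
   Context: $f_1:=f$, $f_{k+1}:=f_k*f$, i.e. $f_{k+1}(x)=\int_\mathbb{R} f_k(x-y)f(y)\,\mathrm{d}y$. For $n\in\mathbb{N}$ and $h\in L^\infty(\mathbb{R})$, the function $\Phi_n(h)$ is defined by $\Phi_n(h)(x):=2\int_{\{z:\,|z|>(|x|-3)/2\}}f_n(z)\,h(x-z)\,\mathrm{d}z$ for $x\in\mathbb{R}$. *)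

(* Defs.v *)
From HB Require Import structures.
From mathcomp Require Import all_boot all_order all_algebra.
From mathcomp Require Import all_classical all_reals all_analysis.
Set Implicit Arguments. Unset Strict Implicit. Unset Printing Implicit Defensive.
Import Order.TTheory GRing.Theory Num.Theory.
Import numFieldNormedType.Exports.
Local Open Scope classical_set_scope.
Local Open Scope ring_scope.
Local Open Scope ereal_scope.

Section Defs.
Variable R : realType.
Local Notation mu := (@lebesgue_measure R).

(* fconv f n = f_{n+1}; values in \bar R (integrals of nonnegative functions) *)
Fixpoint fconv (f : R -> R) (n : nat) : R -> \bar R :=
  match n with
  | 0 => fun x => (f x)%:E
  | n'.+1 => fun x => \int[mu]_(y in setT) (fconv f n' (x - y)%R * (f y)%:E)
  end.

(* f_k, for k >= 1 (f_0 is junk = f) *)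
Definition fpow (f : R -> R) (k : nat) : R -> \bar R := fconv f k.-1.

Definition Phi (f : R -> R) (n : nat) (h : R -> R) (x : R) : \bar R :=
  2%:E * \int[mu]_(z in [set z : R | ((`|x| - 3) / 2 < `|z|)%R])
            (fpow f n z * (h (x - z)%R)%:E).

Definition bounded_density (f : R -> R) : Prop :=
  [/\ measurable_fun setT f, (forall x, (0 <= f x)%R),
      \int[mu]_(x in setT) (f x)%:E = 1
    & exists M : R, forall x, (f x <= M)%R].

Definition Linfty_nonneg (h : R -> R) : Prop :=
  [/\ measurable_fun setT h, (forall x, (0 <= h x)%R)
    & exists M : R, {ae mu, forall x, (`|h x| <= M)%R}].
End Defs.

(* Main.v *)
From mathcomp Require Import all_boot all_order all_algebra.
Require Import Defs.
From mathcomp Require Import all_classical all_reals all_analysis.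
From mathcomp Require Import measurable_realfun.
From mathcomp.algebra_tactics Require Import ring lra.
Import Order.TTheory GRing.Theory Num.Theory.
Local Open Scope classical_set_scope.
Local Open Scope ring_scope.
Local Open Scope ereal_scope.

(* Since f_{2l} = f_l * f_l, it suffices to bound the self-convolution
   g * g of the nonnegative function g = f_l at x in [a, a+1).  For
   B = {y : |y| >= |x|/2}, every y satisfies y in B or x - y in B, so by
   the symmetry y <-> x - y, (g * g)(x) <= 2 int g(x - y) g(y) 1_B(y) dy.
   The hypothesis, applied on the window of a - y, bounds g(x - y) by
   int_{[a-1, a+2]} h(w - y) dw; after exchanging the integrals by Tonelli,
   it remains to note that w in [a-1, a+2] and y in B force
   |y| > (|w| - 3)/2, which is the domain of integration of Phi_l(h)(w). *)

(* [ge0_le_integral] without the measurability of the larger integrand. *)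
Section ge0_le_integral_measurable_l.
Context d (T : measurableType d) (R : realType).
Variable mu : {measure set T -> \bar R}.
Variables (D : set T) (mD : measurable D) (f1 f2 : T -> \bar R).
Hypothesis f10 : forall x, D x -> 0 <= f1 x.
Hypothesis mf1 : measurable_fun D f1.

Import HBNNSimple.

Lemma ge0_le_integral_measurable_l : (forall x, D x -> f1 x <= f2 x) ->
  \int[mu]_(x in D) f1 x <= \int[mu]_(x in D) f2 x.
Proof.
move=> f12; rewrite !(integral_mkcond D).
set h1 := f1 \_ D; set h2 := f2 \_ D.
have h10 x : 0 <= h1 x by apply: erestrict_ge0.
have h20 x : 0 <= h2 x.
  by apply: erestrict_ge0 => // t /[dup] Dt /f12; apply: le_trans; exact: f10.
have mh1 : measurable_fun setT h1 by exact/(measurable_restrictT _ _).1.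
have h12 x : h1 x <= h2 x by apply: lee_restrict.
pose g1 := nnsfun_approx measurableT mh1.
rewrite (@nd_ge0_integral_lim _ _ _ _ _ g1)//; last 2 first.
- by move=> x m n mn; exact/lefP/nd_nnsfun_approx.
- by move=> x; exact: cvg_nnsfun_approx.
apply: lime_le.
  by apply: is_cvg_sintegral => // t m n mn; exact/lefP/nd_nnsfun_approx.
near=> n; rewrite ge0_integralTE//; apply: ereal_sup_ubound => /=.
exists (g1 n) => // t; rewrite (le_trans _ (h12 _))//.
by rewrite /g1 nnsfun_approxE; apply: le_approx.
Unshelve. all: by end_near. Qed.

End ge0_le_integral_measurable_l.

Section lebesgue_measure_invariance.
Context {R : realType}.
Local Notation mu := (@lebesgue_measure R).

Lemma measurable_addr (c : R) :
  measurable_fun setT ((fun x : R => x + c)%R : R -> measurableTypeR R).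
Proof. exact: measurable_funD. Qed.

Lemma measurable_subl (x : R) : measurable_fun setT (fun y : R => x - y)%R.
Proof. exact: measurable_funB. Qed.

Lemma lebesgue_measureD (c : R) (A : set R) : measurable A ->
  pushforward mu ((fun x : R => x + c)%R : R -> measurableTypeR R) A = mu A.
Proof.
move=> mA; have := measurable_addr c => mc; apply/esym.
apply: (lebesgue_measure_unique (mu := pushforward mu _)) => //= _ [[a b]] _ <-.
rewrite /pushforward (_ : _ @^-1` _ = `](a - c)%R, (b - c)%R]%classic); last first.
  by apply/seteqP; split => x /=; rewrite !in_itv /= ltrBlDr lerBrDr.
rewrite !lebesgue_measure_itv/= !lte_fin ltrD2r.
by case: ifP => // _; rewrite -!EFinD; congr EFin; lra.
Qed.

Lemma ge0_integral_addr (g : R -> \bar R) (c : R) :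
  measurable_fun setT g -> (forall x, 0 <= g x) ->
  \int[mu]_x g (x + c)%R = \int[mu]_x g x.
Proof.
move=> mg g0; have mc := measurable_addr c.
have -> : \int[mu]_x g x = \int[pushforward mu
    ((fun x : R => x + c)%R : R -> measurableTypeR R)]_x g x.
  apply: (eq_measure_integral (pushforward mu _)) => //= A mA _.
  exact/esym/lebesgue_measureD.
by rewrite ge0_integral_pushforward//= preimage_setT.
Qed.

Lemma ge0_integralN (g : R -> \bar R) :
  measurable_fun setT g -> (forall x, 0 <= g x) ->
  \int[mu]_x g (- x)%R = \int[mu]_x g x.
Proof.
move=> mg g0.
have -> : \int[mu]_x g x = \int[pushforward mu (-%R : _ -> measurableTypeR R)]_x g x.
  apply: (eq_measure_integral (pushforward mu _)) => //= A mA _.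
  exact/esym/lebesgue_measureN.
by rewrite ge0_integral_pushforward//= preimage_setT.
Qed.

Lemma ge0_integral_subl (g : R -> \bar R) (c : R) :
  measurable_fun setT g -> (forall x, 0 <= g x) ->
  \int[mu]_x g (c - x)%R = \int[mu]_x g x.
Proof.
move=> mg g0; have gc0 x : 0 <= g (x + c)%R := g0 _.
have mgc := measurableT_comp mg (measurable_addr c).
rewrite -(ge0_integral_addr _ c mg g0) -(ge0_integralN _ mgc)//.
by apply: eq_integral => x _; rewrite addrC.
Qed.

End lebesgue_measure_invariance.

Section nonnegative_convolution.
Context {R : realType}.
Local Notation mu := (@lebesgue_measure R).

Definition econv (g k : R -> \bar R) (x : R) : \bar R :=
  \int[mu]_y (g (x - y)%R * k y).

Variables g k p : R -> \bar R.
Hypotheses (mg : measurable_fun setT g) (mk : measurable_fun setT k).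
Hypotheses (mp : measurable_fun setT p).
Hypotheses (g0 : forall x, 0 <= g x) (k0 : forall x, 0 <= k x).
Hypothesis p0 : forall x, 0 <= p x.

Lemma econv_ge0 x : 0 <= econv g k x.
Proof. by apply: integral_ge0 => y _; apply: mule_ge0. Qed.

Lemma measurable_econv : measurable_fun setT (econv g k).
Proof.
have M : measurable_fun setT (fun q : R * R => g (q.1 - q.2)%R * k q.2).
  apply: emeasurable_funM; last exact: measurableT_comp mk measurable_snd.
  exact: measurableT_comp mg (measurable_funB measurable_fst measurable_snd).
exact: (@measurable_fun_fubini_tonelli_F _ _ _ _ _ mu _ M
  (fun q => mule_ge0 (g0 _) (k0 _))).
Qed.

Lemma econvA x : econv (econv g k) p x = econv g (econv k p) x.
Proof.
rewrite /econv.
transitivity (\int[mu]_y \int[mu]_u (g (x - u)%R * k (u - y)%R * p y)).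
  apply: eq_integral => y _.
  have mgk : measurable_fun setT (fun z : R => g (x - y - z)%R * k z).
    by apply: emeasurable_funM => //; exact: measurableT_comp mg (measurable_subl _).
  rewrite -ge0_integralZr//; last by move=> z _; apply: mule_ge0.
  rewrite -(ge0_integral_addr _ (- y)%R (emeasurable_funM mgk (measurable_cst (p y))));
    last by move=> z /=; rewrite !mule_ge0.
  by apply: eq_integral => u _; rewrite (_ : x - y - (u - y) = x - u)%R //; ring.
transitivity (\int[mu]_u \int[mu]_y (g (x - u)%R * k (u - y)%R * p y)).
  have M : measurable_fun setT
      (fun q : R * R => g (x - q.2)%R * k (q.2 - q.1)%R * p q.1).
    apply: emeasurable_funM; last exact: measurableT_comp mp measurable_fst.
    apply: emeasurable_funM.
      exact: measurableT_comp mg (measurable_funB (measurable_cst x) measurable_snd).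
    exact: measurableT_comp mk (measurable_funB measurable_snd measurable_fst).
  exact: (@fubini_tonelli _ _ _ _ _ mu mu _ M
    (fun q => mule_ge0 (mule_ge0 (g0 _) (k0 _)) (p0 _))).
apply: eq_integral => u _; under eq_integral do rewrite -muleA.
rewrite ge0_integralZl//; last by move=> y _; apply: mule_ge0.
by apply: emeasurable_funM => //; exact: measurableT_comp mk (measurable_subl _).
Qed.

Lemma econv_self_le_restrict (x : R) (B : set R) : measurable B ->
  (forall y, ~ B y -> B (x - y)%R) ->
  econv g g x <= 2%:E * \int[mu]_y (g (x - y)%R * (g y * (\1_B y)%:E)).
Proof.
move=> mB HB; pose q y := g (x - y)%R * (g y * (\1_B y)%:E).
have mgx : measurable_fun setT (fun y : R => g (x - y)%R).
  exact: measurableT_comp mg (measurable_subl x).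
have mq : measurable_fun setT q.
  apply: emeasurable_funM => //; apply: emeasurable_funM => //.
  exact/measurable_EFinP/measurable_indic.
have q0 y : 0 <= q y by rewrite /q !mule_ge0// lee_fin.
have mqx : measurable_fun setT (fun y : R => q (x - y)%R).
  exact: measurableT_comp mq (measurable_subl x).
have -> : 2%:E * \int[mu]_y q y = \int[mu]_y (q y + q (x - y)%R).
  by rewrite ge0_integralD// ge0_integral_subl// -mule2n -mule_natl.
apply: ge0_le_integral => //.
- by move=> y _; apply: mule_ge0.
- exact: emeasurable_funM mgx mg.
- exact: emeasurable_funD mq mqx.
move=> y _; rewrite /q; have [yB|/HB xyB] := pselect (B y).
  by rewrite indicE (mem_set yB) mule1 leeDl// !mule_ge0// lee_fin.
rewrite [\1_B (x - y)%R]indicE (mem_set xyB) mule1 subKr muleC.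
by rewrite leeDr// !mule_ge0// lee_fin.
Qed.

End nonnegative_convolution.

Section iterated_convolution.
Context {R : realType}.
Variable f : R -> R.
Hypotheses (mf : measurable_fun setT f) (f0 : forall x, (0 <= f x)%R).

Let Ef0 x : 0 <= (f x)%:E. Proof. by rewrite lee_fin. Qed.

Lemma fconv_ge0 n x : 0 <= fconv f n x.
Proof. by elim: n x => [|n IH] x //=; exact: econv_ge0. Qed.

Lemma measurable_fconv n : measurable_fun setT (fconv f n).
Proof.
elim: n => [|n IH]; first exact/measurable_EFinP.
apply: (measurable_econv _ _ IH _ (fconv_ge0 n) Ef0); exact/measurable_EFinP.
Qed.

Lemma fconv_addn n m x : fconv f (n + m).+1 x = econv (fconv f n) (fconv f m) x.
Proof.
elim: m x => [|m IH] x; first by rewrite addn0.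
rewrite addnS.
transitivity (econv (econv (fconv f n) (fconv f m)) (fconv f 0) x).
  change (econv (fconv f (n + m).+1) (fconv f 0) x =
    econv (econv (fconv f n) (fconv f m)) (fconv f 0) x).
  by apply: eq_integral => y _; rewrite IH.
by rewrite econvA //; solve [exact: measurable_fconv | exact: fconv_ge0].
Qed.

Lemma fpow_double l x : fpow f (2 * l.+1) x = econv (fconv f l) (fconv f l) x.
Proof. by rewrite /fpow mulnS mul2n -addnn addSn -fconv_addn. Qed.

End iterated_convolution.

Lemma far_from_window (R : realFieldType) (a x w y : R) :
  (a <= x < a + 1 -> a - 1 <= w <= a + 2 -> `|x| / 2 <= `|y| ->
  (`|w| - 3) / 2 < `|y|)%R.
Proof.
move=> /andP[ax xa] /andP[aw wa] xy.
have := ler_normD x (w - x)%R; rewrite (addrC x) subrK.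
have : (`|w - x| <= 2)%R by rewrite ler_norml; apply/andP; split; lra.
lra.
Qed.

Section window_bound.
Context {R : realType}.
Local Notation mu := (@lebesgue_measure R).

Definition window (a : R) : set R := `[(a - 1)%R, (a + 2)%R]%classic.

Lemma measurable_window a : measurable (window a).
Proof. exact: measurable_itv. Qed.

Variables (g : R -> \bar R) (h : R -> R).
Hypotheses (mg : measurable_fun setT g) (g0 : forall x, 0 <= g x).
Hypotheses (mh : measurable_fun setT h) (h0 : forall w, (0 <= h w)%R).
Hypothesis g_le_window : forall b t, (b <= t < b + 1)%R ->
  g t <= \int[mu]_(w in window b) (h w)%:E.

Lemma mem_window_subr (a y w : R) :
  ((w - y)%R \in window (a - y)%R) = (w \in window a).
Proof.
rewrite /window; apply/idP/idP => /set_mem; rewrite /= !in_itv /= => /andP[w1 w2];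
  by apply/mem_set; rewrite /= in_itv /=; apply/andP; split; lra.
Qed.

Lemma g_le_shifted_window (a x y : R) : (a <= x < a + 1)%R ->
  g (x - y)%R <= \int[mu]_w ((\1_(window a) w)%:E * (h (w - y)%R)%:E).
Proof.
move=> /andP[ax xa]; apply: le_trans (g_le_window (a - y)%R (x - y)%R _) _.
  by apply/andP; split; lra.
rewrite integral_mkcond epatch_indic -[leLHS](ge0_integral_addr _ (- y)%R).
- rewrite le_eqVlt; apply/predU1l/eq_integral => w _ /=.
  by rewrite muleC !indicE mem_window_subr.
- apply: emeasurable_funM; first exact/measurable_EFinP.
  by apply/measurable_EFinP; exact: measurable_indic (measurable_window (a - y)%R).
- by move=> w /=; rewrite mule_ge0// lee_fin.
Qed.

Variables (a x : R).
Hypothesis x_in : (a <= x < a + 1)%R.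

Let B := [set y : R | (`|x| / 2 <= `|y|)%R].

Let mB : measurable B.
Proof.
rewrite (_ : B = Num.Def.normr @^-1` `[(`|x| / 2)%R, +oo[); last first.
  by apply/seteqP; split => y; rewrite /B /= in_itv /= andbT.
by rewrite -[X in measurable X]setTI; apply: normr_measurable.
Qed.

Let B_subl y : ~ B y -> B (x - y)%R.
Proof. by rewrite /B /= => /negP; rewrite -ltNge => hy; have := lerB_dist x y; lra. Qed.

Let F (q : R * R) : \bar R :=
  (\1_(window a) q.2)%:E * (h (q.2 - q.1))%:E * (g q.1 * (\1_B q.1)%:E).

Let mF : measurable_fun setT F.
Proof.
apply: emeasurable_funM; apply: emeasurable_funM.
- apply/measurable_EFinP.
  exact: measurableT_comp (measurable_indic (measurable_window a)) measurable_snd.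
- apply/measurable_EFinP; apply: measurableT_comp mh _.
  exact: measurable_funB measurable_snd measurable_fst.
- exact: measurableT_comp mg measurable_fst.
- apply/measurable_EFinP; exact: measurableT_comp (measurable_indic mB) measurable_fst.
Qed.

Let F0 q : 0 <= F q. Proof. by rewrite /F !mule_ge0// lee_fin. Qed.

Let econv_self_le_iterated :
  econv g g x <= 2%:E * \int[mu]_y \int[mu]_w F (y, w).
Proof.
apply: le_trans (econv_self_le_restrict _ mg g0 _ _ mB B_subl) _.
rewrite lee_wpmul2l//; apply: ge0_le_integral => //.
- by move=> y _; rewrite !mule_ge0// lee_fin.
- apply: emeasurable_funM; first exact: measurableT_comp mg (measurable_subl x).
  apply: emeasurable_funM => //; exact/measurable_EFinP/measurable_indic.
- exact: (@measurable_fun_fubini_tonelli_F _ _ _ _ _ mu _ mF F0).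
move=> y _; rewrite /F /= ge0_integralZr//.
- by rewrite lee_wpmul2r ?mule_ge0 ?lee_fin//; exact: (g_le_shifted_window a x y x_in).
- apply: emeasurable_funM; apply/measurable_EFinP.
    exact: measurable_indic (measurable_window a).
  apply: measurableT_comp mh _.
  exact: measurable_funB (@measurable_id _ _ setT) (measurable_cst y).
- by move=> w _; rewrite mule_ge0// lee_fin.
- by rewrite mule_ge0// lee_fin.
Qed.

Let iterated_le_window :
  2%:E * \int[mu]_y \int[mu]_w F (y, w) <=
  \int[mu]_(w in window a) (2%:E * \int[mu]_(z in [set z : R | ((`|w| - 3) / 2 < `|z|)%R])
     (g z * (h (w - z)%R)%:E)).
Proof.
rewrite (@fubini_tonelli _ _ _ _ _ mu mu _ mF F0) /=.
rewrite -ge0_integralZl//; last 2 first.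
- exact: (@measurable_fun_fubini_tonelli_G _ _ _ _ _ mu _ mF F0).
- by move=> w _; apply: integral_ge0.
rewrite [leRHS]integral_mkcond; apply: ge0_le_integral_measurable_l => //.
- by move=> w _; rewrite mule_ge0//; apply: integral_ge0.
- apply: emeasurable_funM => //.
  exact: (@measurable_fun_fubini_tonelli_G _ _ _ _ _ mu _ mF F0).
move=> w _; rewrite patchE; case: ifPn => wI; last first.
  rewrite (eq_integral (fun _ => 0)) ?integral0 ?mule0// => y _.
  by rewrite /F /= indicE (negbTE wI) !mul0e.
rewrite lee_wpmul2l ?lee_fin// [leRHS]integral_mkcond.
apply: ge0_le_integral_measurable_l => //.
  apply: measurableT_comp mF _.
  exact: measurable_fun_pair (@measurable_id _ _ setT) (measurable_cst w).
move=> y _; rewrite /F /= indicE wI mul1e patchE.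
have [yB|yB] := pselect (B y); last first.
  by rewrite indicE (memNset yB) !mule0; case: ifPn => _; rewrite ?mule_ge0 ?lee_fin.
have y_far : [set z : R | ((`|w| - 3) / 2 < `|z|)%R] y.
  move/set_mem: wI; rewrite /window /= in_itv /= => wI; exact: far_from_window x_in wI yB.
by rewrite indicE (mem_set yB) mule1 (mem_set y_far) muleC.
Qed.

Lemma econv_self_le_window :
  econv g g x <= \int[mu]_(w in window a)
    (2%:E * \int[mu]_(z in [set z : R | ((`|w| - 3) / 2 < `|z|)%R])
              (g z * (h (w - z)%R)%:E)).
Proof. exact: le_trans econv_self_le_iterated iterated_le_window. Qed.

End window_bound.

Theorem lemma3p3 (R : realType) (f h : R -> R) (l : nat) :
  bounded_density f -> Linfty_nonneg h -> (1 <= l)%N ->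
  (forall a : R,
     ereal_sup [set fpow f l x | x in `[a, (a + 1)%R[%classic] <=
     \int[@lebesgue_measure R]_(w in `[(a - 1)%R, (a + 2)%R]%classic) (h w)%:E) ->
  forall a : R,
    ereal_sup [set fpow f (2 * l) x | x in `[a, (a + 1)%R[%classic] <=
    \int[@lebesgue_measure R]_(w in `[(a - 1)%R, (a + 2)%R]%classic) Phi f l h w.
Proof.
move=> [mf f0 _ _] [mh h0 _]; case: l => // l _ fl_le_window a.
have fconv_le_window b t : (b <= t < b + 1)%R ->
    fconv f l t <= \int[lebesgue_measure]_(w in window b) (h w)%:E.
  move=> tb; apply: le_trans (fl_le_window b); apply: ereal_sup_ubound.
  by exists t => //=; rewrite in_itv.
apply: ge_ereal_sup => _ [x xa <-]; rewrite fpow_double//.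
by apply: econv_self_le_window => //; [exact: measurable_fconv | exact: fconv_ge0].
Qed.
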